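(* The $\mathbf{Q}$-algebra $\mathcal{U}_0^+(Q)$ is defined by generators $E_i$ for $i\in I$ and relations $$E_i^{n+1}E_j=E_i^nE_jE_i,\qquad E_iE_j^{n+1}=E_jE_iE_j^n,$$ for all $i,j\in I$ such that there is no arrow from $j$ to $i$, where $n$ is the number of arrows from $i$ to $j$.
   Context: $Q$ is a finite quiver without oriented cycles with vertex set $I$. For nonnegative integers $M,N$, set $[M]!=(q-1)(q^2-1)\cdots(q^M-1)$ and $\left[{M+N\atop M}\right]=\frac{[M+N]!}{[M]!\,[N]!}\in\mathbf{Z}[q]$. $\mathcal{U}^+(Q)$ is the (associative, unital) $\mathbf{Q}[q]$-algebra with generators $E_i$ for $i\in I$ and relations $$\sum_{p+p'=n+1}(-1)^{p'}q^{p'(p'-1)}\left[{p+p'\atop p}\right]E_i^pE_jE_i^{p'}=0,\qquad \sum_{p+p'=n+1}(-1)^{p}q^{p(p-1)}\left[{p+p'\atop p}\right]E_j^pE_iE_j^{p'}=0,$$ for all $i,j\in I$ such that there is no arrow from $j$ to $i$, where $n$ is the number of arrows from $i$ to $j$. $\mathcal{U}_0^+(Q)$ is the $\mathbf{Q}$-algebra obtained from $\mathcal{U}^+(Q)$ by specializing $q$ to $0$, i.e. $\mathcal{U}_0^+(Q)=\mathbf{Q}\otimes_{\mathbf{Q}[q]}\mathcal{U}^+(Q)$ with $q$ acting on $\mathbf{Q}$ as $0$. *)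

(* Defs.v *)
From HB Require Import structures.
From mathcomp Require Import all_boot all_order all_algebra.
From mathcomp Require Import generic_quotient ring_quotient.
From mathcomp Require Import finmap ring.
From mathcomp.multinomials Require Import monalg.
From mathcomp.classical Require Import boolp.

Set Implicit Arguments.
Unset Strict Implicit.
Unset Printing Implicit Defensive.

Import GRing.Theory.
Local Open Scope ring_scope.
Local Open Scope quotient_scope.

Section TwoSidedIdeal.
Variable A : pzRingType.

Inductive two_sided_ideal (S : A -> Prop) : A -> Prop :=
| ideal_gen x : S x -> two_sided_ideal S x
| ideal_0 : two_sided_ideal S 0
| ideal_B x y :
    two_sided_ideal S x -> two_sided_ideal S y -> two_sided_ideal S (x - y)
| ideal_Ml a x : two_sided_ideal S x -> two_sided_ideal S (a * x)
| ideal_Mr a x : two_sided_ideal S x -> two_sided_ideal S (x * a).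

Definition ideal_pred (S : A -> Prop) :=
  fun x : A => `[< two_sided_ideal S x >].

Lemma ideal_predP S x : reflect (two_sided_ideal S x) (x \in ideal_pred S).
Proof. exact: asboolP. Qed.

Lemma ideal_pred_zmod_closed S : zmod_closed (ideal_pred S).
Proof.
split=> [|x y /ideal_predP xI /ideal_predP yI]; apply/ideal_predP.
  exact: ideal_0.
exact: ideal_B.
Qed.

HB.instance Definition _ S :=
  GRing.isZmodClosed.Build A (ideal_pred S) (ideal_pred_zmod_closed S).

Definition generated_ideal S : zmodClosed A :=
  GRing.ZmodClosed.clone A (ideal_pred S) _.

End TwoSidedIdeal.

Section Presentation.
Variables (R : comNzRingType) (I : choiceType).

(* The free associative R-algebra on I: the algebra of the free monoid on I.  *)
Definition free_alg := {malg R[{fmonom I}]}.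

HB.instance Definition _ := GRing.Lalgebra.on free_alg.

Definition free_gen (i : I) : free_alg := << fmu i >>.

Lemma free_algC c (x : free_alg) : x * c%:MP = c *: x.
Proof.
rewrite -mul_malgC !malgM_def fgmulUg fgmulgU.
by apply: eq_bigr => k _; rewrite mulrC mulm1 mul1m.
Qed.

Variable S : free_alg -> Prop.

(* The R-algebra with generators I and relations x = 0 for x in S. It is only *)
(* a [pzRingType] and an [lmodType R] (with [pres_scaleAl], [pres_scaleAr]):  *)
(* relations may define the zero ring, which [algType R] excludes.            *)
Definition presented := Quotient.quot (generated_ideal S).

HB.instance Definition _ := Choice.on presented.
HB.instance Definition _ := GRing.Zmodule.on presented.
HB.instance Definition _ := EqQuotient.on presented.

Implicit Types x y z : free_alg.

Fact pres_piP x y : reflect (\pi_presented x = \pi_presented y)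
                      (x - y \in ideal_pred S).
Proof. by rewrite (Quotient.idealrBE (generated_ideal S)); apply: eqP. Qed.

Fact pres_piD x y : \pi_presented (x + y) = \pi_presented x + \pi_presented y.
Proof. exact: (Quotient.pi_add (generated_ideal S)). Qed.

Definition pres_one : presented := \pi_presented 1.
Definition pres_mul (u v : presented) : presented := \pi_presented (repr u * repr v).
Definition pres_scale (c : R) (u : presented) : presented := \pi_presented (c *: repr u).

Fact pres_piM x y : pres_mul (\pi_presented x) (\pi_presented y) = \pi_presented (x * y).
Proof.
apply/pres_piP; set x' := repr _; set y' := repr _.
have /ideal_predP xI : x' - x \in ideal_pred S by apply/pres_piP; rewrite reprK.
have /ideal_predP yI : y' - y \in ideal_pred S by apply/pres_piP; rewrite reprK.
have -> : x' * y' - x * y = (x' - x) * y' - x * - (y' - y).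
  by rewrite mulrBl mulrN opprK mulrBr addrA subrK.
apply/ideal_predP; apply: ideal_B; first exact: ideal_Mr.
by apply: ideal_Ml; rewrite -sub0r; apply: ideal_B => //; apply: ideal_0.
Qed.

Fact pres_piZ c x : pres_scale c (\pi_presented x) = \pi_presented (c *: x).
Proof.
apply/pres_piP; set x' := repr _.
have /ideal_predP xI : x' - x \in ideal_pred S by apply/pres_piP; rewrite reprK.
by apply/ideal_predP; rewrite -scalerBr -mul_malgC; apply: ideal_Ml.
Qed.

Fact pres_ind (P : presented -> Prop) : (forall x, P (\pi_presented x)) -> forall u, P u.
Proof. by move=> Ppi u; rewrite -[u]reprK. Qed.

Fact pres_mulA : associative pres_mul.
Proof.
by elim/pres_ind=> x; elim/pres_ind=> y; elim/pres_ind=> z; rewrite !pres_piM mulrA.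
Qed.

Fact pres_mul1r : left_id pres_one pres_mul.
Proof. by elim/pres_ind=> x; rewrite pres_piM mul1r. Qed.

Fact pres_mulr1 : right_id pres_one pres_mul.
Proof. by elim/pres_ind=> x; rewrite pres_piM mulr1. Qed.

Fact pres_mulDl : left_distributive pres_mul +%R.
Proof.
elim/pres_ind=> x; elim/pres_ind=> y; elim/pres_ind=> z.
by rewrite -pres_piD !pres_piM mulrDl pres_piD.
Qed.

Fact pres_mulDr : right_distributive pres_mul +%R.
Proof.
elim/pres_ind=> x; elim/pres_ind=> y; elim/pres_ind=> z.
by rewrite -pres_piD !pres_piM mulrDr pres_piD.
Qed.

HB.instance Definition _ := GRing.Zmodule_isPzRing.Build presented
  pres_mulA pres_mul1r pres_mulr1 pres_mulDl pres_mulDr.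

Fact pres_scaleA a b u : pres_scale a (pres_scale b u) = pres_scale (a * b) u.
Proof. by elim/pres_ind: u => x; rewrite !pres_piZ scalerA. Qed.

Fact pres_scale1 : left_id 1 pres_scale.
Proof. by elim/pres_ind=> x; rewrite pres_piZ scale1r. Qed.

Fact pres_scaleDr : right_distributive pres_scale +%R.
Proof.
by move=> c; elim/pres_ind=> x; elim/pres_ind=> y; rewrite -pres_piD !pres_piZ scalerDr pres_piD.
Qed.

Fact pres_scaleDl u : {morph pres_scale^~ u : a b / a + b}.
Proof. by elim/pres_ind: u => x a b; rewrite !pres_piZ scalerDl pres_piD. Qed.

HB.instance Definition _ := GRing.Zmodule_isLmodule.Build R presented
  pres_scaleA pres_scale1 pres_scaleDr pres_scaleDl.

Fact pres_scaleAl (c : R) (u v : presented) : c *: (u * v) = (c *: u) * v.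
Proof.
elim/pres_ind: u => x; elim/pres_ind: v => y.
change (pres_scale c (pres_mul (\pi_presented x) (\pi_presented y)) =
        pres_mul (pres_scale c (\pi_presented x)) (\pi_presented y)).
by rewrite !(pres_piM, pres_piZ) -scalerAl.
Qed.

Fact pres_scaleAr (c : R) (u v : presented) : c *: (u * v) = u * (c *: v).
Proof.
elim/pres_ind: u => x; elim/pres_ind: v => y.
change (pres_scale c (pres_mul (\pi_presented x) (\pi_presented y)) =
        pres_mul (\pi_presented x) (pres_scale c (\pi_presented y))).
by rewrite !(pres_piM, pres_piZ) -free_algC -mulrA free_algC.
Qed.

Definition pres_gen (i : I) : presented := \pi_presented (free_gen i).

(* The constant term; well defined when the relations have none.              *)
Definition pres_aug (u : presented) : R := mcoeff mone (repr u).

Section Augmented.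
Hypothesis S_aug : forall x, S x -> mcoeff mone x = 0.

Fact generated_ideal_aug x : two_sided_ideal S x -> mcoeff mone x = 0.
Proof.
elim=> {x} [x /S_aug //||x y _ hx _ hy|a x _ hx|a x _ hx].
- exact: mcoeff0.
- by rewrite mcoeffB hx hy subr0.
- by rewrite (rmorphM (mcoeff (mone : {fmonom I}))) /= hx mulr0.
- by rewrite (rmorphM (mcoeff (mone : {fmonom I}))) /= hx mul0r.
Qed.

Lemma pres_augE x : pres_aug (\pi_presented x) = mcoeff mone x.
Proof.
have /ideal_predP/generated_ideal_aug : repr (\pi_presented x) - x \in ideal_pred S.
  by apply/pres_piP; rewrite reprK.
by rewrite mcoeffB => /eqP; rewrite subr_eq0 => /eqP.
Qed.

Lemma pres_aug1 : pres_aug 1 = 1.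
Proof. by rewrite pres_augE (rmorph1 (mcoeff (mone : {fmonom I}))). Qed.

Lemma pres_augD : {morph pres_aug : u v / u + v}.
Proof.
elim/pres_ind=> x; elim/pres_ind=> y.
by rewrite -pres_piD !pres_augE mcoeffD.
Qed.

Lemma pres_augZ c u : pres_aug (c *: u) = c * pres_aug u.
Proof.
elim/pres_ind: u => x; change (c *: \pi_presented x)
  with (pres_scale c (\pi_presented x)).
by rewrite pres_piZ !pres_augE mcoeffZ.
Qed.

Lemma pres_oner_neq0 : (1 : presented) != 0.
Proof.
apply/eqP => e; have := pres_aug1; rewrite e -[0](scale0r 0) pres_augZ mul0r.
by move/eqP; rewrite eq_sym oner_eq0.
Qed.

End Augmented.

(* A is defined by generators e i and relations x = 0 for x in S.             *)
Definition presented_by (A : algType R) (e : I -> A) : Prop :=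
  exists f : {rmorphism presented -> A},
    [/\ scalable f, bijective f & forall i, f (pres_gen i) = e i].

End Presentation.

Section TensorProduct.
Variables (R T : comPzRingType) (phi : {rmorphism R -> T}) (A : algType R).

(* T \otimes_R A, with R acting on T through phi: finite formal sums of pure  *)
(* tensors modulo bilinearity. The congruence [tsum_eq] is imposed on the     *)
(* free commutative monoid; [tsum_0l] makes (- t) \otimes a the opposite of   *)
(* t \otimes a, so the quotient is the usual abelian group.                   *)
Definition tsum := seq (T * A).

Inductive tsum_eq : tsum -> tsum -> Prop :=
| tsum_refl s : tsum_eq s s
| tsum_sym s1 s2 : tsum_eq s1 s2 -> tsum_eq s2 s1
| tsum_trans s1 s2 s3 : tsum_eq s1 s2 -> tsum_eq s2 s3 -> tsum_eq s1 s3
| tsum_cat s1 s2 s3 s4 :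
    tsum_eq s1 s2 -> tsum_eq s3 s4 -> tsum_eq (s1 ++ s3) (s2 ++ s4)
| tsum_catC s1 s2 : tsum_eq (s1 ++ s2) (s2 ++ s1)
| tsum_0l a : tsum_eq [:: (0, a)] [::]
| tsum_Dl t t' a : tsum_eq [:: (t + t', a)] [:: (t, a); (t', a)]
| tsum_Dr t a a' : tsum_eq [:: (t, a + a')] [:: (t, a); (t, a')]
| tsum_bal t r a : tsum_eq [:: (t * phi r, a)] [:: (t, r *: a)].

Definition tsum_eqb (s1 s2 : tsum) : bool := `[< tsum_eq s1 s2 >].

Fact tsum_eqb_equiv : equiv_class_of tsum_eqb.
Proof.
split=> [s|s1 s2|s2 s1 s3]; first by apply/asboolP; apply: tsum_refl.
  by apply/asboolP/asboolP; apply: tsum_sym.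
by move=> /asboolP h /asboolP k; apply/asboolP; apply: tsum_trans h k.
Qed.

Canonical tsum_equiv := EquivRelPack tsum_eqb_equiv.
Canonical tsum_encModRel := defaultEncModRel tsum_eqb.

Definition tensor := {eq_quot tsum_eqb}.
HB.instance Definition _ := Choice.on tensor.
HB.instance Definition _ := EqQuotient.on tensor.

Fact tens_piP (s1 s2 : tsum) :
  (\pi_tensor s1 = \pi_tensor s2) <-> tsum_eq s1 s2.
Proof.
split=> [/eqP|h]; first by rewrite piE => /asboolP.
by apply/eqP; rewrite piE; apply/asboolP.
Qed.

Definition tsum_scale (t : T) (s : tsum) : tsum := [seq (t * p.1, p.2) | p <- s].
Definition tsum_mul (s1 s2 : tsum) : tsum :=
  [seq (p.1 * p'.1, p.2 * p'.2) | p <- s1, p' <- s2].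

Definition tens_zero : tensor := \pi_tensor [::].
Definition tens_opp (u : tensor) : tensor := \pi_tensor (tsum_scale (- 1) (repr u)).
Definition tens_add (u v : tensor) : tensor := \pi_tensor (repr u ++ repr v).
Definition tens_one : tensor := \pi_tensor [:: (1, 1)].
Definition tens_mul (u v : tensor) : tensor := \pi_tensor (tsum_mul (repr u) (repr v)).
Definition tens_scale (t : T) (u : tensor) : tensor :=
  \pi_tensor (tsum_scale t (repr u)).

Fact tsum_repr (s : tsum) : tsum_eq (repr (\pi_tensor s)) s.
Proof. by apply/tens_piP; rewrite reprK. Qed.

Fact tsum_scale_eq t s s' : tsum_eq s s' -> tsum_eq (tsum_scale t s) (tsum_scale t s').
Proof.
elim=> {s s'} /=.
- by move=> s; apply: tsum_refl.
- by move=> s s' _; apply: tsum_sym.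
- by move=> s1 s2 s3 _ h _; apply: tsum_trans h.
- by move=> s1 s2 s3 s4 _ h _ k; rewrite /tsum_scale !map_cat; apply: tsum_cat.
- by move=> s1 s2; rewrite /tsum_scale !map_cat; apply: tsum_catC.
- by move=> a; rewrite mulr0; apply: tsum_0l.
- by move=> t1 t2 a; rewrite mulrDr; apply: tsum_Dl.
- by move=> t1 a a'; apply: tsum_Dr.
- by move=> t1 r a; rewrite mulrA; apply: tsum_bal.
Qed.

Fact tsum_mul1_eq p s s' : tsum_eq s s' -> tsum_eq (tsum_mul [:: p] s) (tsum_mul [:: p] s').
Proof.
case: p => t b; rewrite /tsum_mul /= !cats0.
elim=> {s s'} /=.
- by move=> s; apply: tsum_refl.
- by move=> s s' _; apply: tsum_sym.
- by move=> s1 s2 s3 _ h _; apply: tsum_trans h.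
- by move=> s1 s2 s3 s4 _ h _ k; rewrite !map_cat; apply: tsum_cat.
- by move=> s1 s2; rewrite !map_cat; apply: tsum_catC.
- by move=> a; rewrite mulr0; apply: tsum_0l.
- by move=> t1 t2 a; rewrite mulrDr; apply: tsum_Dl.
- by move=> t1 a a'; rewrite mulrDr; apply: tsum_Dr.
- by move=> t1 r a; rewrite mulrA -scalerAr; apply: tsum_bal.
Qed.

Fact tsum_mul_cons p s s' : tsum_mul (p :: s) s' = tsum_mul [:: p] s' ++ tsum_mul s s'.
Proof. by rewrite /tsum_mul /= cats0. Qed.

Fact tsum_mul_catl s1 s2 s : tsum_mul (s1 ++ s2) s = tsum_mul s1 s ++ tsum_mul s2 s.
Proof. by rewrite /tsum_mul map_cat flatten_cat. Qed.

Fact tsum_mulr_eq s1 s s' : tsum_eq s s' -> tsum_eq (tsum_mul s1 s) (tsum_mul s1 s').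
Proof.
move=> h; elim: s1 => [|p s1 IH]; first exact: tsum_refl.
by rewrite !(tsum_mul_cons p s1); apply: tsum_cat => //; apply: tsum_mul1_eq.
Qed.

Fact tsum_catACA s1 s2 s3 s4 :
  tsum_eq ((s1 ++ s2) ++ (s3 ++ s4)) ((s1 ++ s3) ++ (s2 ++ s4)).
Proof.
rewrite -!catA; apply: tsum_cat; first exact: tsum_refl.
by rewrite !catA; apply: tsum_cat; [apply: tsum_catC | apply: tsum_refl].
Qed.

Fact tsum_mulr1E (s : tsum) p : tsum_eq (tsum_mul s [:: p])
   [seq (q.1 * p.1, q.2 * p.2) | q <- s].
Proof.
rewrite /tsum_mul; elim: s => [|q s IH] /=; first exact: tsum_refl.
by apply: (tsum_cat (tsum_refl [:: _])).
Qed.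

Fact tsum_mul_consr s p s' :
  tsum_eq (tsum_mul s (p :: s')) (tsum_mul s [:: p] ++ tsum_mul s s').
Proof.
elim: s => [|q s IH]; first exact: tsum_refl.
rewrite !(tsum_mul_cons q s).
apply: tsum_trans (tsum_cat (tsum_refl _) IH) _.
have -> : tsum_mul [:: q] (p :: s') = tsum_mul [:: q] [:: p] ++ tsum_mul [:: q] s'.
  by rewrite /tsum_mul /= !cats0.
exact: tsum_catACA.
Qed.

Fact tsum_mull1_eq p s s' : tsum_eq s s' -> tsum_eq (tsum_mul s [:: p]) (tsum_mul s' [:: p]).
Proof.
move=> h; apply: tsum_trans (tsum_mulr1E s p) _.
apply: tsum_trans (tsum_sym (tsum_mulr1E s' p)).
case: p => t b; elim: h => {s s'} /=.
- by move=> s; apply: tsum_refl.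
- by move=> s s' _; apply: tsum_sym.
- by move=> s1 s2 s3 _ h _; apply: tsum_trans h.
- by move=> s1 s2 s3 s4 _ h _ k; rewrite !map_cat; apply: tsum_cat.
- by move=> s1 s2; rewrite !map_cat; apply: tsum_catC.
- by move=> a; rewrite mul0r; apply: tsum_0l.
- by move=> t1 t2 a; rewrite mulrDl; apply: tsum_Dl.
- by move=> t1 a a'; rewrite mulrDl; apply: tsum_Dr.
- by move=> t1 r a; rewrite mulrAC -scalerAl; apply: tsum_bal.
Qed.

Fact tsum_mull_eq s1 s s' : tsum_eq s s' -> tsum_eq (tsum_mul s s1) (tsum_mul s' s1).
Proof.
move=> h; elim: s1 => [|p s1 IH].
  by rewrite /tsum_mul !allpairs0r; apply: tsum_refl.
apply: tsum_trans (tsum_mul_consr _ _ _) _.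
apply: tsum_trans (tsum_sym (tsum_mul_consr _ _ _)).
by apply: tsum_cat => //; apply: tsum_mull1_eq.
Qed.

Fact tens_piD s s' : tens_add (\pi_tensor s) (\pi_tensor s') = \pi_tensor (s ++ s').
Proof. by apply/tens_piP; apply: tsum_cat; apply: tsum_repr. Qed.

Fact tens_piZ t s : tens_scale t (\pi_tensor s) = \pi_tensor (tsum_scale t s).
Proof. by apply/tens_piP; apply: tsum_scale_eq; apply: tsum_repr. Qed.

Fact tens_piN s : tens_opp (\pi_tensor s) = \pi_tensor (tsum_scale (- 1) s).
Proof. exact: tens_piZ. Qed.

Fact tens_piM s s' : tens_mul (\pi_tensor s) (\pi_tensor s') = \pi_tensor (tsum_mul s s').
Proof.
apply/tens_piP; apply: tsum_trans (tsum_mull_eq _ (tsum_repr s)) _.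
by apply: tsum_mulr_eq; apply: tsum_repr.
Qed.

Fact tens_ind (P : tensor -> Prop) : (forall s, P (\pi_tensor s)) -> forall u, P u.
Proof. by move=> Ppi u; rewrite -[u]reprK. Qed.

Fact tens_addA : associative tens_add.
Proof.
by elim/tens_ind=> s1; elim/tens_ind=> s2; elim/tens_ind=> s3; rewrite !tens_piD catA.
Qed.

Fact tens_addC : commutative tens_add.
Proof.
elim/tens_ind=> s1; elim/tens_ind=> s2; rewrite !tens_piD.
by apply/tens_piP; apply: tsum_catC.
Qed.

Fact tens_add0 : left_id tens_zero tens_add.
Proof. by elim/tens_ind=> s; rewrite tens_piD. Qed.

Fact tens_addN : left_inverse tens_zero tens_opp tens_add.
Proof.
elim/tens_ind=> s; rewrite tens_piN tens_piD; apply/tens_piP.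
elim: s => [|[t a] s IH] /=; first exact: tsum_refl.
apply: (tsum_trans (tsum_catACA [:: _] (tsum_scale (- 1) s) [:: _] s)).
apply: (tsum_cat (s2 := [::]) _ IH) => /=.
apply: tsum_trans (tsum_sym (tsum_Dl _ _ _)) _.
by rewrite mulN1r addNr; apply: tsum_0l.
Qed.

HB.instance Definition _ := GRing.isZmodule.Build tensor
  tens_addA tens_addC tens_add0 tens_addN.

Fact tsum_mul1E t b s : tsum_mul [:: (t, b)] s = [seq (t * q.1, b * q.2) | q <- s].
Proof. by rewrite /tsum_mul /= cats0. Qed.

Fact tens_mulA : associative tens_mul.
Proof.
elim/tens_ind=> s1; elim/tens_ind=> s2; elim/tens_ind=> s3; rewrite !tens_piM.
congr (\pi_tensor _); elim: s1 => [//|[t a] s1 IH].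
rewrite tsum_mul_cons [tsum_mul (_ :: _) s2]tsum_mul_cons tsum_mul_catl IH; congr cat.
rewrite !tsum_mul1E; elim: s2 {IH} => [//|[t' a'] s2 IH] /=.
rewrite tsum_mul_cons map_cat [in RHS]tsum_mul_cons IH; congr cat.
by rewrite !tsum_mul1E -map_comp; apply: eq_map => q /=; rewrite !mulrA.
Qed.

Fact tens_mul1r : left_id tens_one tens_mul.
Proof.
elim/tens_ind=> s; rewrite tens_piM tsum_mul1E; congr (\pi_tensor _).
by rewrite -[RHS]map_id; apply: eq_map => -[t a] /=; rewrite !mul1r.
Qed.

Fact tens_mulr1 : right_id tens_one tens_mul.
Proof.
elim/tens_ind=> s; rewrite tens_piM; apply/tens_piP.
apply: tsum_trans (tsum_mulr1E _ _) _ => /=.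
rewrite (eq_map (g := id)) ?map_id; first exact: tsum_refl.
by case=> t a /=; rewrite !mulr1.
Qed.

Fact tens_mulDl : left_distributive tens_mul +%R.
Proof.
elim/tens_ind=> s1; elim/tens_ind=> s2; elim/tens_ind=> s3.
change (tens_mul (tens_add (\pi_tensor s1) (\pi_tensor s2)) (\pi_tensor s3) =
  tens_add (tens_mul (\pi_tensor s1) (\pi_tensor s3)) (tens_mul (\pi_tensor s2) (\pi_tensor s3))).
by rewrite !(tens_piD, tens_piM) tsum_mul_catl.
Qed.

Fact tens_mulDr : right_distributive tens_mul +%R.
Proof.
elim/tens_ind=> s1; elim/tens_ind=> s2; elim/tens_ind=> s3.
change (tens_mul (\pi_tensor s1) (tens_add (\pi_tensor s2) (\pi_tensor s3)) =
  tens_add (tens_mul (\pi_tensor s1) (\pi_tensor s2)) (tens_mul (\pi_tensor s1) (\pi_tensor s3))).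
rewrite !(tens_piD, tens_piM); apply/tens_piP; elim: s1 => [|p s1 IH]; first exact: tsum_refl.
rewrite !(tsum_mul_cons p s1); apply: tsum_trans (tsum_cat (tsum_refl _) IH) _.
case: p => t a; rewrite !tsum_mul1E map_cat; exact: tsum_catACA.
Qed.

HB.instance Definition _ := GRing.Zmodule_isPzRing.Build tensor
  tens_mulA tens_mul1r tens_mulr1 tens_mulDl tens_mulDr.

Fact tens_scaleA a b u : tens_scale a (tens_scale b u) = tens_scale (a * b) u.
Proof.
elim/tens_ind: u => s; rewrite !tens_piZ /tsum_scale -map_comp; congr (\pi_tensor _).
by apply: eq_map => q /=; rewrite mulrA.
Qed.

Fact tens_scale1 : left_id 1 tens_scale.
Proof.
elim/tens_ind=> s; rewrite tens_piZ; congr (\pi_tensor _).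
by rewrite -[RHS]map_id; apply: eq_map => -[t a] /=; rewrite mul1r.
Qed.

Fact tens_scaleDr : right_distributive tens_scale +%R.
Proof.
move=> t; elim/tens_ind=> s1; elim/tens_ind=> s2.
change (tens_scale t (tens_add (\pi_tensor s1) (\pi_tensor s2)) =
  tens_add (tens_scale t (\pi_tensor s1)) (tens_scale t (\pi_tensor s2))).
by rewrite !(tens_piD, tens_piZ) /tsum_scale map_cat.
Qed.

Fact tens_scaleDl u : {morph tens_scale^~ u : a b / a + b}.
Proof.
elim/tens_ind: u => s t t'.
change (tens_scale (t + t') (\pi_tensor s) =
  tens_add (tens_scale t (\pi_tensor s)) (tens_scale t' (\pi_tensor s))).
rewrite !(tens_piD, tens_piZ); apply/tens_piP; elim: s => [|[t1 a] s IH] /=.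
  exact: tsum_refl.
apply: tsum_trans (tsum_catACA [:: _] [:: _] _ _).
by apply: (tsum_cat (s1 := [:: _]) _ IH); rewrite mulrDl; apply: tsum_Dl.
Qed.

HB.instance Definition _ := GRing.Zmodule_isLmodule.Build T tensor
  tens_scaleA tens_scale1 tens_scaleDr tens_scaleDl.

Fact tens_scaleAl (t : T) (u v : tensor) : t *: (u * v) = (t *: u) * v.
Proof.
elim/tens_ind: u => s; elim/tens_ind: v => s'.
change (tens_scale t (tens_mul (\pi_tensor s) (\pi_tensor s')) =
        tens_mul (tens_scale t (\pi_tensor s)) (\pi_tensor s')).
rewrite !(tens_piM, tens_piZ) /tsum_mul /tsum_scale map_allpairs allpairs_mapl.
by congr (\pi_tensor _); apply: eq_allpairs => p q /=; rewrite mulrA.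
Qed.

Fact tens_scaleAr (t : T) (u v : tensor) : t *: (u * v) = u * (t *: v).
Proof.
elim/tens_ind: u => s; elim/tens_ind: v => s'.
change (tens_scale t (tens_mul (\pi_tensor s) (\pi_tensor s')) =
        tens_mul (\pi_tensor s) (tens_scale t (\pi_tensor s'))).
rewrite !(tens_piM, tens_piZ) /tsum_mul /tsum_scale map_allpairs allpairs_mapr.
by congr (\pi_tensor _); apply: eq_allpairs => p q /=; rewrite mulrCA.
Qed.

Lemma tens_oner_neq0 (aug : A -> R) :
    (1 : T) != 0 -> aug 1 = 1 -> {morph aug : a b / a + b} ->
    (forall r a, aug (r *: a) = r * aug a) ->
  (1 : tensor) != 0.
Proof.
move=> T1 aug1 augD augZ; pose f (s : tsum) := \sum_(p <- s) p.1 * phi (aug p.2).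
have fE s s' : tsum_eq s s' -> f s = f s'.
  rewrite /f; elim=> {s s'} //.
  - by move=> s1 s2 s3 _ -> _.
  - by move=> s1 s2 s3 s4 _ h1 _ h2; rewrite !big_cat /= h1 h2.
  - by move=> s1 s2; rewrite !big_cat /= addrC.
  - by move=> a; rewrite big_seq1 big_nil mul0r.
  - by move=> t t' a; rewrite !big_cons big_nil /= !addr0 mulrDl.
  - by move=> t a a'; rewrite !big_cons big_nil /= !addr0 augD rmorphD mulrDr.
  - by move=> t r a; rewrite !big_seq1 /= augZ rmorphM mulrA.
apply/negP => /eqP/tens_piP/fE; rewrite /f big_seq1 big_nil /= aug1 rmorph1 mulr1.
by move/eqP; apply/negP.
Qed.

Definition pure_tensor (t : T) (a : A) : tensor := \pi_tensor [:: (t, a)].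

End TensorProduct.

(* [qbinom m n] is [m + n]! / ([m]! [n]!), with q written 'X; [%/] is the     *)
(* Euclidean quotient, and [qbinomE] shows that the division is exact.        *)
Definition qfact (m : nat) : {poly int} := \prod_(1 <= k < m.+1) ('X^k - 1).

Definition qbinom (m n : nat) : {poly int} :=
  qfact (m + n) %/ (qfact m * qfact n).

Lemma qfactS m : qfact m.+1 = qfact m * ('X^(m.+1) - 1).
Proof. by rewrite /qfact big_nat_recr. Qed.

Lemma qfact_monic m : qfact m \is monic.
Proof.
elim: m => [|m IH]; first by rewrite /qfact big_geq ?monic1.
by rewrite qfactS monicMr // monicXnsubC.
Qed.

Fact qbinom_step (a b f h g1 g2 : {poly int}) :
  g1 * (f * (h * (b - 1))) = g2 * (f * (a - 1) * h) ->
  (g1 + a * g2) * (f * (a - 1) * (h * (b - 1))) =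
  g2 * (f * (a - 1) * h) * (a * b - 1).
Proof.
move=> e; transitivity (g1 * (f * (h * (b - 1))) * (a - 1)
  + a * (g2 * (f * (a - 1) * h)) * (b - 1)); first by ring.
by rewrite e; ring.
Qed.

Lemma qbinomE m n : qbinom m n * (qfact m * qfact n) = qfact (m + n).
Proof.
have [g gE] : exists g, g * (qfact m * qfact n) = qfact (m + n).
  move: {2}(m + n)%N (erefl (m + n)%N) => d.
  have f0 : qfact 0 = 1 by rewrite /qfact big_geq.
  elim: d m n => [|d IH] [|m] [|n] // eqd; do ?by exists 1; rewrite ?addn0 f0 ?mul1r ?mulr1.
  have [g1 g1E] : exists g, g * (qfact m * qfact n.+1) = qfact (m + n.+1).
    by apply: IH; case: eqd.
  have [g2 g2E] : exists g, g * (qfact m.+1 * qfact n) = qfact (m.+1 + n).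
    by apply: IH; rewrite -addSnnS in eqd; case: eqd.
  exists (g1 + 'X^(m.+1) * g2); rewrite addSn (qfactS (m + n.+1)) -addSn exprD.
  move: g1E; rewrite -addSnnS -g2E !qfactS.
  by move: ('X^(m.+1)) ('X^(n.+1)) (qfact m) (qfact n) => a b f h; apply: qbinom_step.
rewrite /qbinom -gE Pdiv.IdomainMonic.mulpK //.
by rewrite monicMr qfact_monic.
Qed.

Record quiver := Quiver {
  vertex : finType;
  arrow : finType;
  source : arrow -> vertex;
  target : arrow -> vertex
}.

Definition acyclic (Q : quiver) : Prop :=
  forall c : seq (arrow Q),
    cycle (fun a b => target a == source b) c -> c = [::].

Definition arrows (Q : quiver) (i j : vertex Q) : {set arrow Q} :=
  [set a | (source a == i) && (target a == j)].

Section QuantizedAlgebra.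
Variable Q : quiver.

Definition qcoef (p p' k : nat) : {poly rat} :=
  (-1) ^+ k * 'X^(k * (k - 1))%N * map_poly intr (qbinom p p').

Definition quantum_rel_l (n : nat) (i j : vertex Q) :
    free_alg {poly rat} (vertex Q) :=
  \sum_(p < n.+2) \sum_(p' < n.+2 | (p + p' == n.+1)%N)
    qcoef p p' p' *: (free_gen _ i ^+ p * free_gen _ j * free_gen _ i ^+ p').

Definition quantum_rel_r (n : nat) (i j : vertex Q) :
    free_alg {poly rat} (vertex Q) :=
  \sum_(p < n.+2) \sum_(p' < n.+2 | (p + p' == n.+1)%N)
    qcoef p p' p *: (free_gen _ j ^+ p * free_gen _ i * free_gen _ j ^+ p').

Definition quantum_rels (x : free_alg {poly rat} (vertex Q)) : Prop :=
  exists i j, arrows j i = set0 /\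
    (x = quantum_rel_l #|arrows i j| i j \/
     x = quantum_rel_r #|arrows i j| i j).

Fact free_gen_aug (R : comNzRingType) (i : vertex Q) :
  mcoeff mone (free_gen R i) = 0.
Proof. by rewrite mcoeffU1 -val_eqE /= fmU fm1. Qed.

Fact quantum_rels_aug x : quantum_rels x -> mcoeff mone x = 0.
Proof.
have aug0 (c : {poly rat}) (y z : free_alg {poly rat} (vertex Q)) i :
    mcoeff mone (c *: (y * free_gen _ i * z)) = 0.
  rewrite mcoeffZ !(rmorphM (mcoeff (mone : {fmonom (vertex Q)}))).
  by rewrite /= free_gen_aug mulr0 mul0r mulr0.
move=> [i [j [_ [->|->]]]]; rewrite raddf_sum big1 // => p _;
  by rewrite raddf_sum big1 // => p' _; apply: aug0.
Qed.

Definition Uplus := presented quantum_rels.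

HB.instance Definition _ := GRing.PzRing.on Uplus.
HB.instance Definition _ := GRing.Lmodule.on Uplus.
HB.instance Definition _ := GRing.PzSemiRing_isNonZero.Build Uplus
  (pres_oner_neq0 quantum_rels_aug).
HB.instance Definition _ := GRing.Lmodule_isLalgebra.Build {poly rat} Uplus
  (@pres_scaleAl _ _ quantum_rels).
HB.instance Definition _ := GRing.Lalgebra_isAlgebra.Build {poly rat} Uplus
  (@pres_scaleAr _ _ quantum_rels).

Definition Uplus_gen (i : vertex Q) : Uplus := pres_gen quantum_rels i.

(* [horner_eval 0] makes rat a {poly rat}-algebra on which q acts as 0.       *)
Definition Uplus0 := tensor (horner_eval (0 : rat)) Uplus.

HB.instance Definition _ := GRing.PzRing.on Uplus0.
HB.instance Definition _ := GRing.Lmodule.on Uplus0.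
Fact Uplus0_oner_neq0 : (1 : Uplus0) != 0.
Proof.
apply: (@tens_oner_neq0 _ _ (horner_eval 0) Uplus (@pres_aug _ _ quantum_rels)) => //.
- exact: (pres_aug1 quantum_rels_aug).
- exact: (pres_augD quantum_rels_aug).
- exact: (pres_augZ quantum_rels_aug).
Qed.
HB.instance Definition _ := GRing.PzSemiRing_isNonZero.Build Uplus0
  Uplus0_oner_neq0.
HB.instance Definition _ := GRing.Lmodule_isLalgebra.Build rat Uplus0
  (@tens_scaleAl _ _ (horner_eval (0 : rat)) Uplus).
HB.instance Definition _ := GRing.Lalgebra_isAlgebra.Build rat Uplus0
  (@tens_scaleAr _ _ (horner_eval (0 : rat)) Uplus).

Definition Uplus0_gen (i : vertex Q) : Uplus0 :=
  pure_tensor (horner_eval (0 : rat)) 1 (Uplus_gen i).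

Definition specialized_rels (x : free_alg rat (vertex Q)) : Prop :=
  exists i j, arrows j i = set0 /\
    let n := #|arrows i j| in
    let E := @free_gen rat (vertex Q) in
    (x = E i ^+ n.+1 * E j - E i ^+ n * E j * E i \/
     x = E i * E j ^+ n.+1 - E j * E i * E j ^+ n).

End QuantizedAlgebra.

(* Main.v *)
From HB Require Import structures.
Require Import Defs.
From mathcomp Require Import all_boot all_order all_algebra.
From mathcomp Require Import generic_quotient finmap.
From mathcomp.multinomials Require Import monalg.

Set Implicit Arguments.
Unset Strict Implicit.
Unset Printing Implicit Defensive.

Import GRing.Theory.
Local Open Scope ring_scope.
Local Open Scope quotient_scope.

(** The proof has two independent halves.

    The formal half is that presentations are stable under base change: if an
    R-algebra A is generated by the e i subject to S, then T \otimes_R A is the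
    T-algebra generated by the 1 \otimes e i subject to the images of S under
    the coefficientwise map R<I> -> T<I> ([presented_base_change]). Each of
    the three constructions involved has a universal property
    ([free_alg_lift], [presentedP], [tensor_lift]), and these give maps both
    ways: e i |-> 1 \otimes e i from T<I>/S' to the tensor product, and
    t \otimes a |-> t * (the class of a word representing a) back. The two
    composites fix generators and scalars, hence are identities
    ([free_alg_ext]). Taking R = Q[q], T = Q and q |-> 0 shows that U_0^+(Q)
    is presented by the quantum relations with coefficients evaluated at 0.

    The computational half finds these evaluated relations. As
    [m]! is a product of m factors q^k - 1, its value at 0 is (-1)^m, so every
    q-binomial coefficient takes the value 1 at 0 ([qbinom_at0]). The factor
    q^(k(k-1)) vanishes at 0 unless k is 0 or 1; hence exactly two terms of
    each relation survive, with signs 1 and -1 ([qcoef_at0]), namely those of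
    the two monomials in the specialized relation ([specialized_relsP]). *)

(** * Free algebras *)

(** Lets universal properties be stated as existence of a [{rmorphism _ -> _}]
    without declaring a structure instance for each intermediate map. *)
Lemma bundle_rmorphism (A B : pzRingType) (f : A -> B) :
    zmod_morphism f -> monoid_morphism f ->
  exists g : {rmorphism A -> B}, g =1 f.
Proof.
move=> fB fM.
pose fa := GRing.isZmodMorphism.Build _ _ f fB.
pose fm := GRing.isMonoidMorphism.Build _ _ f fM.
pose g : {rmorphism A -> B} := HB.pack f fa fm.
by exists g.
Qed.

Section FreeAlgebra.
Variables (R : comNzRingType) (I : choiceType) (B : pzRingType).

(** Words are written as products of generators so that ring morphisms can be
    pushed through the expansion. *)
Lemma free_alg_basisE (x : free_alg R I) :
  x = \sum_(k <- msupp x) x@_k *: \prod_(i <- (k : seq I)) free_gen R i.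
Proof.
have prodE (s : seq I) : \prod_(i <- s) free_gen R i = << FMonom s >>.
  elim: s => [|i s IH].
    by rewrite big_nil -fmoneE.
  rewrite big_cons IH /free_gen malgM_def fgmulUU mulr1.
  by congr << _ >>; apply: val_inj; rewrite /= fmM fmU.
rewrite [LHS]monalgE; apply: eq_bigr => k _.
rewrite prodE; have -> : FMonom k = k by apply: val_inj.
by rewrite -mul_malgC malgM_def fgmulUU mulr1 mul1m.
Qed.

Lemma free_alg_ext (h1 h2 : {rmorphism free_alg R I -> B}) :
    (forall c, h1 c%:A = h2 c%:A) ->
    (forall i, h1 (free_gen R i) = h2 (free_gen R i)) ->
  h1 =1 h2.
Proof.
move=> hC hG x; rewrite [x]free_alg_basisE !rmorph_sum; apply: eq_bigr => k _.
rewrite -mulr_algl !rmorphM hC !rmorph_prod; congr (_ * _).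
exact: eq_bigr.
Qed.

(** The target may be the zero ring, because a ring given by arbitrary
    relations can collapse. This is also why scalars act through a central
    morphism [iota]: an [algType] is nontrivial. *)
Lemma free_alg_lift (iota : {rmorphism R -> B}) (e : I -> B) :
    (forall c b, GRing.comm (iota c) b) ->
  exists h : {rmorphism free_alg R I -> B},
    (forall c, h c%:A = iota c) /\ (forall i, h (free_gen R i) = e i).
Proof.
move=> iota_central.
pose w (k : {fmonom I}) := \prod_(i <- (k : seq I)) e i.
pose h (x : free_alg R I) := \sum_(k <- msupp x) iota x@_k * w k.
(* The sum may be taken over any larger support, as needed to compare h x,
   h y and h (x - y). *)
have hEw (d : {fset {fmonom I}}) (x : free_alg R I) :
    (msupp x `<=` d)%fset -> h x = \sum_(k <- d) iota x@_k * w k.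
  move=> le_xd; apply: (big_fset_incl _ le_xd) => k _ /mcoeff_outdom ->.
  by rewrite rmorph0 mul0r.
have hU c k : h << c *g k >> = iota c * w k.
  by rewrite (hEw _ _ msuppU_le) big_seq_fset1 mcoeffUU.
have hB : zmod_morphism h.
  move=> x y; rewrite !(hEw (msupp x `|` msupp y)%fset) ?fsubsetUl ?fsubsetUr //.
    by rewrite -sumrB; apply: eq_bigr => k _; rewrite !raddfB mulrBl.
  exact: msuppB_le.
have w1 : w mone = 1 by rewrite /w fm1 big_nil.
have hM : monoid_morphism h.
  split=> [|x y]; first by rewrite hU w1 rmorph1 mulr1.
  have h0 : h 0 = 0 by rewrite -[0]subr0 hB subrr.
  have hD : {morph h : u v / u + v}.
    move=> u v; have hN : h (- v) = - h v by rewrite -[- v]sub0r hB h0 sub0r.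
    by rewrite -[v in LHS]opprK hB hN opprK.
  rewrite malgME (big_morph h hD h0) mulr_suml; apply: eq_bigr => k _.
  rewrite (big_morph h hD h0) mulr_sumr; apply: eq_bigr => l _.
  rewrite hU rmorphM /w fmM big_cat /= -!mulrA; congr (_ * _).
  by rewrite !mulrA iota_central.
have [g gE] := bundle_rmorphism hB hM; exists g; split=> [c|i]; rewrite gE.
  have -> : c%:A = << c *g mone >> :> free_alg R I.
    by rewrite -[LHS]mul_malgC mulr1.
  by rewrite hU w1 mulr1.
by rewrite hU rmorph1 mul1r /w fmU big_seq1.
Qed.

End FreeAlgebra.

(** The coefficientwise map, obtained from the universal property by letting R
    act on T<I> through [phi]. *)
Lemma free_alg_base_change (R T : comNzRingType) (phi : {rmorphism R -> T})
    (I : choiceType) :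
  exists Phi : {rmorphism free_alg R I -> free_alg T I},
    (forall c, Phi c%:A = (phi c)%:A) /\
    (forall i, Phi (free_gen R i) = free_gen T i).
Proof.
pose iota : {rmorphism R -> free_alg T I} := @malgC {fmonom I} T \o phi.
have [|Phi [PhiA Phi_gen]] := @free_alg_lift _ _ _ iota (@free_gen T I).
  by move=> c x; rewrite /GRing.comm /= free_algC mul_malgC.
exists Phi; split=> // c.
by rewrite PhiA /= -[RHS]mul_malgC mulr1.
Qed.

(** * Algebras given by generators and relations *)

Section Presentation.
Variables (R : comNzRingType) (I : choiceType) (S : free_alg R I -> Prop).

(** All that is used below about [presented S], gathered around one abstract
    projection [p], so that later arguments never unfold the quotient. *)
Lemma presentedP :
  exists p : {rmorphism free_alg R I -> presented S},
    [/\ forall c x, p (c *: x) = c *: p x,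
        forall i, p (free_gen R i) = pres_gen S i,
        forall u, exists x, u = p x,
        forall x, S x -> p x = 0 &
        forall (B : pzRingType) (h : {rmorphism free_alg R I -> B}),
          (forall x, S x -> h x = 0) ->
        exists f : {rmorphism presented S -> B}, forall x, f (p x) = h x].
Proof.
have [p pE] : exists p : {rmorphism free_alg R I -> presented S},
    p =1 \pi_(presented S).
  apply: bundle_rmorphism => [x y|].
    apply: (addIr (\pi_(presented S) y)).
    by rewrite -pres_piD !subrK.
  by split=> [|x y]; [exact: erefl | exact/esym/pres_piM].
have p_eq x y : reflect (p x = p y) (x - y \in ideal_pred S).
  rewrite !pE; exact: pres_piP.
exists p; split=> [c x|i|u|x Sx|B h hS].
- rewrite !pE; exact/esym/pres_piZ.
- exact: pE.
- by exists (repr u); rewrite pE reprK.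
- rewrite -(rmorph0 p); apply/p_eq/ideal_predP.
  by rewrite subr0; apply: ideal_gen.
have h_ideal x : two_sided_ideal S x -> h x = 0.
  elim=> {x} [x /hS //||x y _ hx _ hy|a x _ hx|a x _ hx].
  - exact: rmorph0.
  - by rewrite rmorphB hx hy subr0.
  - by rewrite rmorphM hx mulr0.
  - by rewrite rmorphM hx mul0r.
pose f (u : presented S) := h (repr u).
have repr_p u : p (repr u) = u by rewrite pE reprK.
have f_p x : f (p x) = h x.
  apply/eqP; rewrite -subr_eq0 -rmorphB; apply/eqP/h_ideal/ideal_predP/p_eq.
  exact: repr_p.
have fB : zmod_morphism f.
  move=> u v; rewrite -(repr_p u) -(repr_p v).
  by rewrite -rmorphB !f_p rmorphB.
have fM : monoid_morphism f.
  split=> [|u v]; first by rewrite -(rmorph1 p) f_p rmorph1.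
  by rewrite -(repr_p u) -(repr_p v) -rmorphM !f_p rmorphM.
by have [g gE] := bundle_rmorphism fB fM; exists g => x; rewrite gE.
Qed.

End Presentation.

(** * Extension of scalars *)

Section Tensor.
Variables (R T : comPzRingType) (phi : {rmorphism R -> T}) (A : algType R).
Local Notation pure := (pure_tensor phi).

Lemma pure_tensorM t t' (a a' : A) :
  pure t a * pure t' a' = pure (t * t') (a * a').
Proof. exact: (tens_piM phi). Qed.

Lemma pure_tensorDl t t' (a : A) : pure (t + t') a = pure t a + pure t' a.
Proof.
rewrite [RHS](tens_piD phi); apply/(tens_piP phi); exact: tsum_Dl.
Qed.

Lemma pure_tensorDr t (a a' : A) : pure t (a + a') = pure t a + pure t a'.
Proof.
rewrite [RHS](tens_piD phi); apply/(tens_piP phi); exact: tsum_Dr.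
Qed.

Lemma pure_tensor_bal t r (a : A) : pure (t * phi r) a = pure t (r *: a).
Proof. by apply/(tens_piP phi); exact: tsum_bal. Qed.

(** Scaling is multiplication by a pure tensor, so a ring morphism to the
    tensor product is linear as soon as it maps each scalar t to [pure t 1]. *)
Lemma tensor_scaleE t (u : tensor phi A) : t *: u = pure t 1 * u.
Proof.
elim/tens_ind: u => s; rewrite [LHS](tens_piZ phi) [RHS](tens_piM phi).
rewrite tsum_mul1E; congr (\pi _); apply: eq_map => -[t' a] /=.
by rewrite mul1r.
Qed.

Lemma pure_tensor_ind (P : tensor phi A -> Prop) :
    P 0 -> (forall t a u, P u -> P (pure t a + u)) ->
  forall u, P u.
Proof.
move=> P0 PD; elim/tens_ind; elim=> [//|[t a] s IH].
by have := PD t a _ IH; rewrite [_ + _](tens_piD phi).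
Qed.

Lemma pure_tensor_rmorphisms :
  (exists f : {rmorphism T -> tensor phi A}, forall t, f t = pure t 1) /\
  (exists g : {rmorphism A -> tensor phi A}, forall a, g a = pure 1 a).
Proof.
split.
  apply: (@bundle_rmorphism T (tensor phi A) (fun t => pure t 1)).
    move=> t t'; apply: (addIr (pure t' 1)).
    by rewrite -pure_tensorDl !subrK.
  by split=> // t t'; rewrite pure_tensorM mulr1.
apply: (@bundle_rmorphism A (tensor phi A) (fun a => pure 1 a)).
  move=> a a'; apply: (addIr (pure 1 a')).
  by rewrite -pure_tensorDr !subrK.
by split=> // a a'; rewrite pure_tensorM mulr1.
Qed.

(** T \otimes_R A is the pushout of T and A over R among pairs of morphisms
    with commuting images: on formal sums the value is forced, and the
    hypothesis on [beta (r *: a)] is compatibility with the balancing rule. *)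
Lemma tensor_lift (B : pzRingType) (alpha : {rmorphism T -> B})
    (beta : {rmorphism A -> B}) :
    (forall t a, GRing.comm (alpha t) (beta a)) ->
    (forall r a, beta (r *: a) = alpha (phi r) * beta a) ->
  exists g : {rmorphism tensor phi A -> B},
    forall t a, g (pure t a) = alpha t * beta a.
Proof.
move=> comm_ab betaZ.
pose f (s : tsum T A) := \sum_(p <- s) alpha p.1 * beta p.2.
have fE s s' : tsum_eq phi s s' -> f s = f s'.
  rewrite /f; elim=> {s s'} //.
  - by move=> s1 s2 s3 _ -> _.
  - by move=> s1 s2 s3 s4 _ h1 _ h2; rewrite !big_cat /= h1 h2.
  - by move=> s1 s2; rewrite !big_cat /= addrC.
  - by move=> a; rewrite big_seq1 big_nil rmorph0 mul0r.
  - by move=> t t' a; rewrite !big_cons big_nil /= !addr0 rmorphD mulrDl.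
  - by move=> t a a'; rewrite !big_cons big_nil /= !addr0 rmorphD mulrDr.
  - by move=> t r a; rewrite !big_seq1 /= betaZ rmorphM mulrA.
pose g (u : tensor phi A) := f (repr u).
have g_pi s : g (\pi s) = f s by apply/fE/tsum_repr.
have gD : {morph g : u v / u + v}.
  elim/tens_ind=> s; elim/tens_ind=> s'; rewrite [_ + _](tens_piD phi) !g_pi.
  by rewrite /f big_cat.
have gP t a : g (pure t a) = alpha t * beta a by rewrite g_pi /f big_seq1.
have gB : zmod_morphism g.
  by move=> u v; apply: (addIr (g v)); rewrite -gD !subrK.
have gM : monoid_morphism g.
  split=> [|u v]; first by rewrite [LHS]gP !rmorph1 mulr1.
  have g0 : g 0 = 0 by rewrite -[0]subr0 gB subrr.
  elim/pure_tensor_ind: u => [|t a u IHu]; first by rewrite mul0r g0 mul0r.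
  rewrite mulrDl !gD IHu mulrDl; congr (_ + _).
  elim/pure_tensor_ind: v {IHu} => [|t' a' v IHv]; first by rewrite mulr0 g0 mulr0.
  rewrite mulrDr !gD IHv mulrDr pure_tensorM !gP !rmorphM; congr (_ + _).
  by rewrite -!mulrA; congr (_ * _); rewrite !mulrA comm_ab.
by have [h hE] := bundle_rmorphism gB gM; exists h => t a; rewrite hE.
Qed.

End Tensor.

(** * Base change of a presentation *)

Section BaseChange.
Variables (R T : comNzRingType) (phi : {rmorphism R -> T}) (I : choiceType).
Variables (Phi : {rmorphism free_alg R I -> free_alg T I}).
Hypothesis PhiA : forall c, Phi c%:A = (phi c)%:A.
Hypothesis Phi_gen : forall i, Phi (free_gen R i) = free_gen T i.
Variables (S : free_alg R I -> Prop) (S' : free_alg T I -> Prop).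
Hypothesis S'P : forall y, S' y <-> exists2 x, S x & y = Phi x.

(** The quotient by relations and the tensor product are both characterized by
    the maps out of them, and a map from either one to a ring B amounts to a
    morphism T -> B together with images of the generators in B that commute
    with the image of T and satisfy the relations. The proof builds the two comparison maps this
    yields and checks on generators that they are mutually inverse. *)
Theorem presented_base_change (A : algType R) (e : I -> A) :
    presented_by S e ->
  exists f : {rmorphism presented S' -> tensor phi A},
    [/\ scalable f, bijective f &
      forall i, f (pres_gen S' i) = pure_tensor phi 1 (e i)].
Proof.
move=> [k [kZ [k' kK k'K] k_gen]].
have [p [pZ p_gen p_surj pS p_lift]] := presentedP S.
have [p' [p'Z p'_gen p'_surj p'S' p'_lift]] := presentedP S'.
have [[alpha alphaE] [beta betaE]] := pure_tensor_rmorphisms phi A.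
have alpha_central t u : GRing.comm (alpha t) u.
  rewrite /GRing.comm alphaE; elim/pure_tensor_ind: u => [|t' a u IH].
    by rewrite mulr0 mul0r.
  by rewrite mulrDr mulrDl IH !pure_tensorM mul1r mulr1 mulrC.
(* h is evaluation at the 1 \otimes e i; on words with coefficients in R it
   factors through A, which is why it kills the relations S'. *)
have [h [hA h_gen]] := free_alg_lift (fun i => beta (e i)) alpha_central.
have hPhi x : h (Phi x) = beta (k (p x)).
  apply: (@free_alg_ext _ _ _ (h \o Phi) (beta \o k \o p)) x => [c|i] /=.
    rewrite PhiA hA pZ kZ !rmorph1 alphaE betaE.
    by rewrite -pure_tensor_bal mul1r.
  by rewrite Phi_gen h_gen p_gen k_gen.
have [f fE] : exists f : {rmorphism presented S' -> tensor phi A},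
    forall x, f (p' x) = h x.
  apply: p'_lift => y /S'P[x Sx ->].
  by rewrite hPhi pS // !rmorph0.
have [b bE] : exists b : {rmorphism presented S -> presented S'},
    forall x, b (p x) = p' (Phi x).
  have [|b bE] := p_lift _ (p' \o Phi); last by exists b.
  by move=> x Sx /=; rewrite p'S' //; apply/S'P; exists x.
have p'A t x : p' t%:A * p' x = t *: p' x by rewrite -rmorphM mulr_algl p'Z.
have p'A_comm t x : GRing.comm (p' t%:A) (p' x).
  by rewrite /GRing.comm -!rmorphM mulr_algl -[t%:A]mul_malgC mulr1 free_algC.
(* The inverse map g sends t \otimes a to t times b (k' a), with b induced by
   Phi on the presented rings. *)
have scalar_rmorph : zmod_morphism (fun c : T => p' c%:A) /\
    monoid_morphism (fun c : T => p' c%:A).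
  split=> [c c'|]; first by rewrite scalerBl rmorphB.
  by split=> [|c c']; rewrite ?scale1r ?rmorph1 // -rmorphM mulr_algl scalerA.
have [a' a'E] := bundle_rmorphism scalar_rmorph.1 scalar_rmorph.2.
have [c' c'E] : exists c' : {rmorphism A -> presented S}, c' =1 k'.
  apply: bundle_rmorphism; first exact: can2_zmod_morphism kK k'K.
  exact: can2_monoid_morphism kK k'K.
have [g gE] : exists g : {rmorphism tensor phi A -> presented S'},
    forall t a, g (pure_tensor phi t a) = a' t * b (c' a).
  apply: (@tensor_lift _ _ _ _ _ a' (b \o c')) => [t a|r a] /=.
    by have [x ->] := p_surj (c' a); rewrite bE a'E; apply: p'A_comm.
  have [x xE] := p_surj (k' a).
  rewrite !c'E -[a in LHS]k'K -kZ kK xE -pZ !bE a'E p'A.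
  by rewrite -mulr_algl rmorphM PhiA mulr_algl p'Z.
exists f; split.
- move=> t u; have [x ->] := p'_surj u.
  rewrite tensor_scaleE -alphaE -p'A -rmorphM !fE.
  by rewrite rmorphM hA.
- exists g.
    move=> u; have [x ->] := p'_surj u; rewrite fE.
    apply: (@free_alg_ext _ _ _ (g \o h) p') x => [c|i] /=.
      by rewrite hA alphaE gE !rmorph1 mulr1 a'E.
    by rewrite h_gen betaE gE rmorph1 mul1r c'E -k_gen kK -p_gen bE Phi_gen.
  elim/pure_tensor_ind=> [|t a u IH]; first by rewrite !rmorph0.
  rewrite rmorphD rmorphD IH gE; congr (_ + _).
  have [x xE] := p_surj (k' a).
  rewrite rmorphM a'E fE hA c'E xE bE fE hPhi -xE k'K alphaE betaE.
  by rewrite pure_tensorM mulr1 mul1r.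
- by move=> i; rewrite -p'_gen fE h_gen betaE.
Qed.

End BaseChange.

(** * The quantum relations at q = 0 *)

Lemma antidiagonal_sum (V : nmodType) (N : nat) (F : nat -> nat -> V) :
  \sum_(p < N.+1) \sum_(p' < N.+1 | (p + p' == N)%N) F p p' =
  \sum_(p < N.+1) F p (N - p)%N.
Proof.
apply: eq_bigr => p _; rewrite (big_pred1 (rev_ord p)) /= ?subSS // => p'.
rewrite [RHS]/= -val_eqE /= subSS; apply/eqP/eqP => [pp'|->].
  by rewrite -(addKn p p') pp'.
by rewrite subnKC // -ltnS.
Qed.

(** The exact quotient [m + n]! / ([m]! [n]!) is evaluated from the product
    formula, since (-1)^(m + n) = (-1)^m (-1)^n is invertible. *)
Lemma qbinom_at0 m n : (qbinom m n).[0] = 1.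
Proof.
have fact0 k : (qfact k).[0] = (-1) ^+ k.
  elim: k => [|k IH]; first by rewrite /qfact big_geq // hornerC.
  by rewrite qfactS hornerM IH !hornerE expr0n sub0r exprSr.
have /(congr1 (horner^~ 0)) := qbinomE m n.
rewrite !hornerM !fact0 -exprD -[RHS]mul1r; apply: mulIf.
by rewrite signr_eq0.
Qed.

(** The values at q = 0 of (-1)^k q^(k(k-1)): they are 1, -1, 0, 0, etc. *)
Definition qcoef0 (k : nat) : rat :=
  if k is k'.+1 then - (k' == 0)%:R else 1.

Lemma qcoef_at0 p p' k : (qcoef p p' k).[0] = qcoef0 k.
Proof.
have binom1 : (map_poly intr (qbinom p p')).[0] = 1 :> rat.
  by rewrite horner_coef0 coef_map -horner_coef0 qbinom_at0.
rewrite /qcoef !hornerM binom1 mulr1 horner_exp hornerN hornerXn hornerC.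
case: k => [|[|k]] /=; rewrite ?mul1r ?expr0 ?mulr1 //.
by rewrite expr0n mulr0 oppr0.
Qed.

Lemma antidiagonal_qcoef0_r (V : lmodType rat) n (F : nat -> nat -> V) :
  \sum_(p < n.+2) \sum_(p' < n.+2 | (p + p' == n.+1)%N)
      qcoef0 p *: F p p' = F 0 n.+1 - F 1 n.
Proof.
rewrite (antidiagonal_sum _ (fun p p' => qcoef0 p *: F p p')).
rewrite !big_ord_recl big1 => [|p _] /=; last by rewrite oppr0 scale0r.
by rewrite subSS !subn0 scale1r scaleN1r addr0.
Qed.

Lemma antidiagonal_qcoef0_l (V : lmodType rat) n (F : nat -> nat -> V) :
  \sum_(p < n.+2) \sum_(p' < n.+2 | (p + p' == n.+1)%N)
      qcoef0 p' *: F p p' = F n.+1 0 - F n 1.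
Proof.
rewrite -(antidiagonal_qcoef0_r n (fun p p' => F p' p)).
rewrite (exchange_big_dep xpredT) //=; apply: eq_bigr => p _.
by apply: eq_bigl => p'; rewrite addnC.
Qed.

(** * Specialization of the quantized enveloping algebra *)

Section Specialization.
Variables (Q : quiver).
Variable Phi : {rmorphism free_alg {poly rat} (vertex Q) -> free_alg rat (vertex Q)}.
Hypothesis PhiZ : forall c x, Phi (c *: x) = c.[0] *: Phi x.
Hypothesis Phi_gen : forall i, Phi (free_gen _ i) = free_gen _ i.
Local Notation E := (@free_gen rat (vertex Q)).

Lemma Phi_quantum_rel_l n i j :
  Phi (quantum_rel_l n i j) = E i ^+ n.+1 * E j - E i ^+ n * E j * E i.
Proof.
pose F p p' := E i ^+ p * E j * E i ^+ p'.
transitivity (F n.+1 0 - F n 1); last by rewrite [F n.+1 0]mulr1.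
rewrite -antidiagonal_qcoef0_l.
rewrite rmorph_sum; apply: eq_bigr => p _.
rewrite rmorph_sum; apply: eq_bigr => p' _.
by rewrite PhiZ qcoef_at0 !rmorphM !rmorphXn !Phi_gen.
Qed.

Lemma Phi_quantum_rel_r n i j :
  Phi (quantum_rel_r n i j) = E i * E j ^+ n.+1 - E j * E i * E j ^+ n.
Proof.
pose F p p' := E j ^+ p * E i * E j ^+ p'.
transitivity (F 0 n.+1 - F 1 n); last by rewrite /F (mul1r (E i)).
rewrite -antidiagonal_qcoef0_r.
rewrite rmorph_sum; apply: eq_bigr => p _.
rewrite rmorph_sum; apply: eq_bigr => p' _.
by rewrite PhiZ qcoef_at0 !rmorphM !rmorphXn !Phi_gen.
Qed.

Lemma specialized_relsP y :
  specialized_rels y <-> exists2 x, quantum_rels x & y = Phi x.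
Proof.
split=> [[i [j [ji0 [->|->]]]]|[x [i [j [ji0 [->|->]]]] ->]].
- by exists (quantum_rel_l #|arrows i j| i j);
    [exists i, j; split; last left | rewrite Phi_quantum_rel_l].
- by exists (quantum_rel_r #|arrows i j| i j);
    [exists i, j; split; last right | rewrite Phi_quantum_rel_r].
- by exists i, j; split; last left; rewrite ?Phi_quantum_rel_l.
- by exists i, j; split; last right; rewrite ?Phi_quantum_rel_r.
Qed.

End Specialization.

Lemma Uplus_presented (Q : quiver) :
  presented_by (@quantum_rels Q) (@Uplus_gen Q).
Proof.
pose f : {rmorphism presented (@quantum_rels Q) -> Uplus Q} := idfun.
by exists f; split=> //; exists id.
Qed.

Theorem lemma4p2 (Q : quiver) (Q_acyclic : acyclic Q) :
  presented_by (@specialized_rels Q) (@Uplus0_gen Q).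
Proof.
have [Phi [PhiA Phi_gen]] :=
  free_alg_base_change (horner_eval (0 : rat)) (vertex Q).
have PhiZ c x : Phi (c *: x) = c.[0] *: Phi x.
  by rewrite -mulr_algl rmorphM PhiA mulr_algl.
exact: (presented_base_change PhiA Phi_gen (specialized_relsP PhiZ Phi_gen)
          (@Uplus_presented Q)).
Qed.
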